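(* Let $n\ge1$ and $k\ge0$. For $A\in\{1,\dots,n\}^k$ and $B\subset\{1,\dots,n\}$ with $|B|=k+1$, let $\tilde A=c^{1-\rho(A,B)}A$, $\tilde B=c^{1-\rho(A,B)}B$, let $I=(i_1\le\dots\le i_k)$ be the non-decreasing rearrangement of $\tilde A$, let $(j_1,\dots,j_k)=\Pi(I,\tilde B)$, and let $\sigma\in\mathfrak S_k$ be any permutation with $\sigma\cdot\tilde A=I$. Then $i_l<j_l$ for all $l$, $((i_1\,j_1),\dots,(i_k\,j_k))\in\Sigma_n(k)$, and $\Gamma_{n,k}(A,B)=\sigma^{-1}\cdot((i_1\,j_1),\dots,(i_k\,j_k))\in\Sigma_n(k)$ does not depend on the choice of $\sigma$. The resulting map $\Gamma_{n,k}:\{1,\dots,n\}^k\times\binom{\{1,\dots,n\}}{k+1}\to\Sigma_n(k)$ is surjective, and its fibres are exactly the orbits of the shift action of $\mathbb Z/n\mathbb Z$ (generated by $(A,B)\mapsto(cA,cB)$), each of which has exactly $n$ elements. Consequently $|\Sigma_n(k)|=n^{k-1}\binom{n}{k+1}$.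
   Context: $\mathfrak S_n$ is the symmetric group on $\{1,\dots,n\}$; products are composed right to left. $\mathsf T_n$ is the set of transpositions, always written $(i\,j)$ with $i<j$. For $\sigma\in\mathfrak S_n$, $|\sigma|=n-(\text{number of cycles of }\sigma\text{, fixed points counted})$; $\sigma_1\preccurlyeq\sigma_2$ iff $|\sigma_2|=|\sigma_1|+|\sigma_1^{-1}\sigma_2|$. $\Sigma_n(k)=\{(\tau_1,\dots,\tau_k)\in(\mathsf T_n)^k : |\tau_1\cdots\tau_k|=k,\ \tau_1\cdots\tau_k\preccurlyeq(1\,2\,\dots\,n)\}$ (the $k$-prefixes of minimal factorisations of the $n$-cycle). $\binom{\{1,\dots,n\}}{k+1}$ is the set of $(k+1)$-element subsets. Let $c=(1\,2\,\dots\,n)$ be the cyclic shift $x\mapsto x+1$ for $x<n$, $n\mapsto1$, acting componentwise on sequences and elementwise on sets; powers are taken modulo $n$. Parking process: given $E=(e_1,\dots,e_k)\in\{1,\dots,n\}^k$ and $O\subset\{1,\dots,n\}$ with $|O|=k+1$, define $p_k=c^{r}(e_k)$ where $r=\min\{s\in\{1,\dots,n\}: c^s(e_k)\in O\}$ and, backwards, $p_l=c^{r}(e_l)$ where $r=\min\{s\in\{1,\dots,n\}: c^s(e_l)\in O\setminus\{p_{l+1},\dots,p_k\}\}$; $\Pi(E,O)=(p_1,\dots,p_k)$ and the residue $\rho(E,O)$ is the unique element of $O\setminus\{p_1,\dots,p_k\}$. $\mathfrak S_k$ acts on sequences by $\pi\cdot(x_1,\dots,x_k)=(x_{\pi^{-1}(1)},\dots,x_{\pi^{-1}(k)})$,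 and on $\Sigma_n(k)$ as follows: for the generator $\sigma_l=(l\;l+1)$ and $\gamma=((i_1\,j_1),\dots,(i_k\,j_k))=(g_1,\dots,g_k)$, $\sigma_l\cdot\gamma=\gamma$ if $i_l=i_{l+1}$; $\sigma_l\cdot\gamma=(g_1,\dots,g_{l-1},g_{l+1},g_{l+1}^{-1}g_lg_{l+1},g_{l+2},\dots,g_k)$ if $i_l<i_{l+1}$; and $\sigma_l\cdot\gamma=(g_1,\dots,g_{l-1},g_lg_{l+1}g_l^{-1},g_l,g_{l+2},\dots,g_k)$ if $i_l>i_{l+1}$; these generator actions extend to an action of $\mathfrak S_k$ on $\Sigma_n(k)$. *)

(* Defs.v *)
From mathcomp Require Import all_boot all_order all_fingroup.
Set Implicit Arguments. Unset Strict Implicit. Unset Printing Implicit Defensive.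

(* Conventions: the ground set {1,...,n} is represented by 'I_n, the point
   i (1 <= i <= n) being the ordinal i-1.  This preserves the order, and the
   cyclic shift c : x |-> x+1 (n |-> 1) becomes ordS : x |-> x+1 mod n. *)

Section Defs.
Variable n : nat.

(* right-to-left composition of permutations: (rcomp p q) x = p (q x). *)
Definition rcomp (p q : {perm 'I_n}) : {perm 'I_n} := (q * p)%g.

Definition cshift : {perm 'I_n} := perm (@ordS_inj n).

Definition cpow (m : nat) : {perm 'I_n} := (cshift ^+ m)%g.

Definition pabs (s : {perm 'I_n}) : nat := n - #|porbits s|.

Definition pleq (s1 s2 : {perm 'I_n}) : bool :=
  pabs s2 == pabs s1 + pabs (rcomp (s1^-1)%g s2).

(* A transposition (i j), i < j, is represented by the pair (i, j). *)
Definition transp := ('I_n * 'I_n)%type.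
Definition tr (t : transp) : {perm 'I_n} := tperm t.1 t.2.

Definition prod_tr (s : seq transp) : {perm 'I_n} :=
  foldr (fun t acc => rcomp (tr t) acc) 1%g s.

Definition Sigma (k : nat) (s : seq transp) : bool :=
  [&& size s == k, all (fun t : transp => t.1 < t.2) s,
      pabs (prod_tr s) == k & pleq (prod_tr s) cshift].

Definition mktr (a b : 'I_n) : transp := if a < b then (a, b) else (b, a).

(* g^{-1} t g  and  g t g^{-1} for transpositions g, t: as g is an involution,
   both are the transposition (g a  g b) where t = (a b). *)
Definition conj_tr (g t : transp) : transp := mktr (tr g t.1) (tr g t.2).

(* Action of the generator sigma_{l+1} = (l+1 l+2) (positions l, l+1 counted
   from 0) on a sequence of transpositions. *)
Fixpoint gen_act (l : nat) (s : seq transp) : seq transp :=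
  match l, s with
  | 0, g1 :: g2 :: rest =>
      if g1.1 == g2.1 then s
      else if g1.1 < g2.1 then g2 :: conj_tr g2 g1 :: rest
      else conj_tr g1 g2 :: g1 :: rest
  | l'.+1, g :: rest => g :: gen_act l' rest
  | _, _ => s
  end.

(* A word w = [:: l_1; ...; l_m] stands for sigma_{l_1} ... sigma_{l_m}
   (0-indexed positions, composed right to left); it acts by applying
   sigma_{l_m} first. *)
Fixpoint act_word (w : seq nat) (s : seq transp) : seq transp :=
  match w with
  | [::] => s
  | l :: w' => gen_act l (act_word w' s)
  end.

End Defs.

Section SymK.
Variable k : nat.

Definition gen_perm (l : nat) : {perm 'I_k} :=
  match insub l, insub l.+1 with
  | Some a, Some b => tperm a b
  | _, _ => 1%g
  end.

Definition valid_word (w : seq nat) : bool := all (fun l => l.+1 < k) w.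

Fixpoint word_perm (w : seq nat) : {perm 'I_k} :=
  match w with
  | [::] => 1%g
  | l :: w' => (word_perm w' * gen_perm l)%g
  end.

Definition perm_seq_act (T : Type) (pi : {perm 'I_k}) (x : k.-tuple T)
  : k.-tuple T := [tuple tnth x ((pi^-1)%g i) | i < k].
End SymK.

Section Parking.
Variable n : nat.

Definition park_step (avail : {set 'I_n}) (e : 'I_n) : 'I_n :=
  let s := find (fun s => cpow n s.+1 e \in avail) (iota 0 n) in
  cpow n s.+1 e.

Fixpoint park (O : {set 'I_n}) (E : seq 'I_n) : seq 'I_n :=
  match E with
  | [::] => [::]
  | e :: E' =>
      let P := park O E' in park_step (O :\: [set x | x \in P]) e :: P
  end.

(* residue rho(E, O) : the unique element of O \ {p_1..p_k} *)
Definition residue (O : {set 'I_n}) (E : seq 'I_n) : option 'I_n :=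
  [pick x in O :\: [set y | y \in park O E]].

(* the exponent 1 - rho (mod n): if rho is the ordinal v (point v+1), then
   c^(1-rho) = c^(-v) = c^(n-v). *)
Definition rho_exp (O : {set 'I_n}) (E : seq 'I_n) : nat :=
  if residue O E is Some v then n - v else 0.

Definition shiftA k (m : nat) (A : k.-tuple 'I_n) : k.-tuple 'I_n :=
  map_tuple (cpow n m) A.
Definition shiftB (m : nat) (B : {set 'I_n}) : {set 'I_n} := cpow n m @: B.

Variable k : nat.

Definition Atil (A : k.-tuple 'I_n) (B : {set 'I_n}) : k.-tuple 'I_n :=
  shiftA (rho_exp B A) A.
Definition Btil (A : k.-tuple 'I_n) (B : {set 'I_n}) : {set 'I_n} :=
  shiftB (rho_exp B A) B.

Definition Iseq (A : k.-tuple 'I_n) (B : {set 'I_n}) : k.-tuple 'I_n :=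
  sort_tuple (fun x y : 'I_n => x <= y) (Atil A B).

Definition Jseq (A : k.-tuple 'I_n) (B : {set 'I_n}) : seq 'I_n :=
  park (Btil A B) (Iseq A B).

Definition gamma0 (A : k.-tuple 'I_n) (B : {set 'I_n}) : seq (transp n) :=
  zip (Iseq A B) (Jseq A B).

Definition Gamma_is (A : k.-tuple 'I_n) (B : {set 'I_n}) (g : seq (transp n))
  : Prop :=
  forall (sigma : {perm 'I_k}) (w : seq nat),
    perm_seq_act sigma (Atil A B) = Iseq A B ->
    valid_word k w -> word_perm k w = (sigma^-1)%g ->
    act_word w (gamma0 A B) = g.
End Parking.

(* Main.v *)
Require Import Defs.
From mathcomp Require Import all_boot all_order all_fingroup.
From mathcomp Require Import zify.
Set Implicit Arguments. Unset Strict Implicit. Unset Printing Implicit Defensive.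

(** A generator swaps the smaller endpoints [i_l], [i_(l+1)] and keeps the product, so a
sequence of transpositions is determined by its sequence of smaller endpoints together
with its Hurwitz-sorted form, the unique member of its orbit with [i] non-decreasing;
this replaces the presentation of the symmetric group.

For a sorted sequence, multiplying the complement [tau_l ... tau_1 c] by the next
transposition splits a cycle exactly when every interval [[i_l, j_l)] met so far contains
both of its endpoints or neither.  Hence membership in [Sigma] is a pairwise nesting
condition on the intervals, and this is also the condition that the [j_l] are the
outcome of a parking process with residue [0] started from the [i_l].

Shift equivariance of parking and the independence of the set of occupied spots from the
order of the cars reduce a general pair [(A, B)] to one with residue [0]. *)

(** * Hurwitz moves and their sorted normal form *)

Fixpoint swap_at (T : Type) (l : nat) (s : seq T) : seq T :=
  match l, s with
  | 0, x :: y :: r => y :: x :: r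
  | l'.+1, x :: r => x :: swap_at l' r
  | _, _ => s
  end.

Section Hurwitz.
Variable n : nat.
Implicit Types (g h t x y : transp n) (s : seq (transp n)).

Definition proper_tr t := t.1 < t.2.

Definition fst_le x t := x.1 <= t.1.

Definition below g : pred (transp n) := fun x => x.1 < g.1.
Definition above g : pred (transp n) := fun x => g.1 <= x.1.

(** The outcome of pushing [g] to the right by generators: since [g t = (g t g) g], each [t] with
    smaller first endpoint is conjugated as [g] passes it. The filters describe this for sorted [s],
    where the entries below [g.1] form a prefix. *)
Definition insert_tr g s :=
  map (conj_tr g) (filter (below g) s) ++ g :: (filter (above g) s).

Definition hurwitz_sort s := foldr insert_tr [::] s.

(** As [t.1 < g.1 < g.2], the transposition [g] fixes [t.1] and sends [t.2] to itself or to an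
    endpoint of [g], in each case above [t.1]; so [mktr] does not reorder the pair. *)
Lemma conj_trE g t : proper_tr g -> proper_tr t -> t.1 < g.1 ->
  conj_tr g t = (t.1, tr g t.2).
Proof.
rewrite /proper_tr => gP tP lt_tg; rewrite /conj_tr /mktr /tr tpermD.
- by case: tpermP => [e|e|_ _]; rewrite ifT //; lia.
- by apply/eqP=> e; rewrite e ltnn in lt_tg.
- by apply/eqP=> e; move: (ltn_trans lt_tg gP); rewrite e ltnn.
Qed.

Lemma proper_conj_tr g t : proper_tr g -> proper_tr t -> t.1 < g.1 ->
  proper_tr (conj_tr g t).
Proof.
move=> gP tP lt_tg; rewrite conj_trE // /proper_tr /= /tr.
by move: gP tP; rewrite /proper_tr; case: tpermP => [e|e|_ _] //=; lia.
Qed.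

Lemma fst_conj_tr g t : proper_tr g -> proper_tr t -> t.1 < g.1 ->
  (conj_tr g t).1 = t.1.
Proof. by move=> gP tP lt_tg; rewrite conj_trE. Qed.

Lemma tr_mktr (a b : 'I_n) : tr (mktr a b) = tperm a b.
Proof. by rewrite /mktr /tr; case: ifP => _ //=; rewrite tpermC. Qed.

Lemma tr_conj_tr g t : tr (conj_tr g t) = (tr t ^ tr g)%g.
Proof. by rewrite /conj_tr tr_mktr /tr tpermJ. Qed.

Lemma conj_trK g t : proper_tr g -> proper_tr t -> t.1 < g.1 ->
  conj_tr g (conj_tr g t) = t.
Proof.
move=> gP tP lt_tg; rewrite conj_trE ?proper_conj_tr ?fst_conj_tr //.
by rewrite conj_trE //= /tr tpermK -surjective_pairing.
Qed.

(** The smaller endpoint of [t] is fixed throughout; on the larger one the identity is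
    [h (h g h) = g h], as [h] is an involution. *)
Lemma conj_tr_conj g h t : proper_tr g -> proper_tr h -> proper_tr t ->
  t.1 < g.1 -> g.1 < h.1 ->
  conj_tr h (conj_tr (conj_tr h g) t) = conj_tr g (conj_tr h t).
Proof.
move=> gP hP tP tg gh; have th := ltn_trans tg gh.
have cP := proper_conj_tr hP gP gh; have c1 := fst_conj_tr hP gP gh.
rewrite [conj_tr (conj_tr h g) t]conj_trE ?c1 // [conj_tr h t]conj_trE //.
have P1 := proper_conj_tr hP tP th; rewrite conj_trE // in P1.
have P2 : proper_tr (conj_tr (conj_tr h g) t) by rewrite proper_conj_tr ?c1.
rewrite [conj_tr (conj_tr h g) t]conj_trE ?c1 // in P2.
rewrite [LHS]conj_trE // [RHS]conj_trE //=.
by rewrite tr_conj_tr conjgE /tr tpermV !permM tpermK.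
Qed.

Lemma conj_tr_below g s : proper_tr g -> all proper_tr s ->
  {in (filter (below g) s), forall x, [/\ proper_tr x, x.1 < g.1,
     proper_tr (conj_tr g x) & (conj_tr g x).1 = x.1]}.
Proof.
move=> gP /allP sP x; rewrite mem_filter => /andP[lt_xg /sP xP].
by split=> //; [apply: proper_conj_tr | apply: fst_conj_tr].
Qed.

Lemma proper_insert g s : proper_tr g -> all proper_tr s ->
  all proper_tr (insert_tr g s).
Proof.
move=> gP sP; rewrite all_cat /= gP /=; apply/andP; split.
  by apply/allP=> _ /mapP[x /(conj_tr_below gP sP)[_ _ cP _] ->].
by apply/allP=> x; rewrite mem_filter => /andP[_ /(allP sP)].
Qed.

Lemma proper_hurwitz_sort s : all proper_tr s -> all proper_tr (hurwitz_sort s).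
Proof. by elim: s => //= g s IH /andP[gP /IH]; apply: proper_insert. Qed.

Lemma perm_fst_insert g s : proper_tr g -> all proper_tr s ->
  perm_eq (map fst (insert_tr g s)) (g.1 :: map fst s).
Proof.
move=> gP sP; rewrite map_cat /= perm_catC /= perm_cons perm_catC.
have -> : map fst (map (conj_tr g) (filter (below g) s))
       = map fst (filter (below g) s).
  rewrite -map_comp; apply/eq_in_map => x xs /=.
  by have [] := conj_tr_below gP sP xs.
rewrite -map_cat; apply: perm_map.
have -> : (filter (above g) s) = filter (predC (below g)) s.
  by apply: eq_filter => x /=; rewrite /below -leqNgt.
by apply/permPl/perm_filterC.
Qed.

Lemma perm_fst_hurwitz_sort s : all proper_tr s ->
  perm_eq (map fst (hurwitz_sort s)) (map fst s).
Proof.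
elim: s => //= g s IH /andP[gP sP].
apply: perm_trans (perm_fst_insert gP (proper_hurwitz_sort sP)) _.
by rewrite perm_cons IH.
Qed.

Lemma sorted_insert g s : proper_tr g -> all proper_tr s ->
  pairwise fst_le s -> pairwise fst_le (insert_tr g s).
Proof.
move=> gP sP sS; have cP := conj_tr_below gP sP.
rewrite pairwise_cat pairwise_cons pairwise_filter // andbT.
apply/and3P; split.
- apply/allrelP=> _ y /mapP[x xs ->]; have [xP xg _ e] := cP _ xs.
  rewrite inE mem_filter /fst_le e => /orP[/eqP->|/andP[gy _]]; first exact: ltnW.
  by rewrite ltnW // (leq_trans xg).
- rewrite pairwise_map; move: (pairwise_filter (below g) sS).
  apply: (@sub_in_pairwise _ (mem (filter (below g) s))); last exact/allP.
  move=> x y xs ys /=; have [_ _ _ ex] := cP _ xs; have [_ _ _ ey] := cP _ ys.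
  by rewrite /fst_le ex ey.
- by apply/allP=> x; rewrite mem_filter => /andP[].
Qed.

Lemma sorted_hurwitz_sort s : all proper_tr s -> pairwise fst_le (hurwitz_sort s).
Proof.
elim: s => //= g s IH /andP[gP sP].
by apply: sorted_insert; rewrite ?proper_hurwitz_sort ?IH.
Qed.

Lemma hurwitz_sort_id s : pairwise fst_le s -> hurwitz_sort s = s.
Proof.
elim: s => //= g s IH /andP[gs /IH->]; rewrite /insert_tr.
have -> : (filter (below g) s) = [::].
  apply/eqP; rewrite -[_ == _]negbK -has_filter; apply/hasPn => x /(allP gs).
  by rewrite /fst_le -leqNgt.
by rewrite (all_filterP gs).
Qed.

Lemma sorted_split g s : pairwise fst_le s ->
  s = (filter (below g) s) ++ (filter (above g) s).
Proof.
elim: s => //= x s IH /andP[xs /IH {1}->].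
rewrite /below /above; case: ltnP => //= gx; have gs : all (above g) s.
  by apply/allP=> y /(allP xs); apply: leq_trans.
rewrite (_ : (filter (below g) s) = [::]) //.
apply/eqP; rewrite -[_ == _]negbK -has_filter; apply/hasPn => y /(allP gs).
by rewrite -leqNgt.
Qed.

Lemma prod_tr_cat s s' : prod_tr (s ++ s') = (prod_tr s' * prod_tr s)%g.
Proof. by elim: s => /= [|t s ->]; rewrite ?mulg1 // /rcomp mulgA. Qed.

Lemma prod_tr_conj g s :
  prod_tr (map (conj_tr g) s) = (prod_tr s ^ tr g)%g.
Proof. by elim: s => /= [|t s ->]; rewrite ?conj1g // /rcomp tr_conj_tr conjMg. Qed.

Lemma prod_insert g s : pairwise fst_le s -> prod_tr (insert_tr g s) = prod_tr (g :: s).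
Proof.
move=> sS; rewrite [in RHS](sorted_split g sS) prod_tr_cat /= prod_tr_conj /rcomp.
rewrite prod_tr_cat conjgE /tr tpermV -!mulgA; congr (_ * _)%g.
by rewrite mulgA tperm2 mul1g.
Qed.

Lemma prod_hurwitz_sort s : all proper_tr s -> prod_tr (hurwitz_sort s) = prod_tr s.
Proof.
elim: s => //= g s IH /andP[gP sP].
by rewrite prod_insert /= ?IH // sorted_hurwitz_sort.
Qed.

Lemma size_hurwitz_sort s : all proper_tr s -> size (hurwitz_sort s) = size s.
Proof.
by move=> sP; rewrite -(size_map fst) (perm_size (perm_fst_hurwitz_sort sP)) size_map.
Qed.

Lemma below_above g h s : g.1 <= h.1 -> filter (below g) (filter (above h) s) = [::].
Proof.
move=> gh; rewrite -filter_predI (@eq_filter _ _ pred0) ?filter_pred0 // => x /=.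
by rewrite /below /above; apply/negP => /andP[]; lia.
Qed.

Lemma below_insert g s : proper_tr g -> all proper_tr s ->
  filter (below g) (insert_tr g s) = map (conj_tr g) (filter (below g) s).
Proof.
move=> gP sP; have gg : below g g = false by rewrite /below ltnn.
rewrite filter_cat /= gg below_above // cats0.
apply/all_filterP/allP => _ /mapP[x xs ->].
by have [_ xg _ e] := conj_tr_below gP sP xs; rewrite /below e.
Qed.

(** Conjugation keeps first endpoints, so both results split at the common value [g.1]. The heads of
    the upper parts give [g = h], and then the involution [conj_tr h] is undone on the lower
    parts. *)
Lemma insert_tr_inj g h s s' : proper_tr g -> proper_tr h ->
  all proper_tr s -> all proper_tr s' ->
  pairwise fst_le s -> pairwise fst_le s' ->
  g.1 = h.1 -> insert_tr g s = insert_tr h s' -> g = h /\ s = s'.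
Proof.
move=> gP hP sP s'P sS s'S gh e.
have eb : below g = below h by rewrite /below gh.
have elo := below_insert gP sP; rewrite e eb below_insert // in elo.
move: e; rewrite /insert_tr eb elo => /eqP; rewrite eqseq_cat // eqxx /=.
rewrite eqseq_cons => /andP[/eqP egh /eqP ehi].
split=> //; rewrite (sorted_split g sS) (sorted_split h s'S) ehi eb; congr (_ ++ _).
move: elo; rewrite egh => /(congr1 (map (conj_tr h))); rewrite -!map_comp => elo.
have idK r : all proper_tr r ->
   map (conj_tr h \o conj_tr h) (filter (below h) r) = filter (below h) r.
  move=> rP; rewrite -[RHS]map_id; apply/eq_in_map => x xr /=.
  by have [? ? _ _] := conj_tr_below hP rP xr; rewrite conj_trK.
by rewrite -[LHS]idK // -[RHS]idK.
Qed.

Lemma hurwitz_sort_inj s s' : all proper_tr s -> all proper_tr s' ->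
  map fst s = map fst s' -> hurwitz_sort s = hurwitz_sort s' -> s = s'.
Proof.
elim: s s' => [|g s IH] [|h s'] //= /andP[gP sP] /andP[hP s'P] [gh ss'] e.
have [-> e'] := insert_tr_inj gP hP (proper_hurwitz_sort sP) (proper_hurwitz_sort s'P)
  (sorted_hurwitz_sort sP) (sorted_hurwitz_sort s'P) gh e.
by rewrite (IH s').
Qed.

(** Cut [s] at [g.1] and [h.1]. Both sides consist of the lowest block conjugated twice, [g], the
    middle block conjugated by [h], then [h] and the top block; [conj_tr_conj] matches the lowest
    blocks. *)
Lemma insert_trC g h s : proper_tr g -> proper_tr h -> all proper_tr s ->
  g.1 < h.1 -> insert_tr g (insert_tr h s) = insert_tr h (insert_tr (conj_tr h g) s).
Proof.
move=> gP hP sP gh; have cP := proper_conj_tr hP gP gh.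
have c1 := fst_conj_tr hP gP gh.
have eb : below (conj_tr h g) = below g by rewrite /below c1.
have ea : above (conj_tr h g) = above g by rewrite /above c1.
have eloh r : filter (below g) (filter (below h) r) = filter (below g) r.
  rewrite -filter_predI; apply: eq_filter => x /=; rewrite /below.
  by case: ltnP => // /ltn_trans -> .
have ehi r : filter (above h) (filter (above g) r) = filter (above h) r.
  rewrite -filter_predI; apply: eq_filter => x /=; rewrite /above.
  by case: leqP => // /(leq_trans (ltnW gh)) ->.
(* A test on first endpoints commutes with [conj_tr h] here, because it preserves first endpoints
   below [h.1]. *)
have fc (p : pred (transp n)) : (forall x y : transp n, x.1 = y.1 -> p x = p y) ->
    filter p (map (conj_tr h) (filter (below h) s)) =
    map (conj_tr h) (filter p (filter (below h) s)).
  move=> pE; rewrite filter_map; congr map; apply: eq_in_filter => x xs /=.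
  by apply: pE; have [] := conj_tr_below hP sP xs.
rewrite {1 3}/insert_tr /insert_tr !filter_cat /= eb ea !fc ?eloh ?ehi; first last.
- by move=> x y; rewrite /below => ->.
- by move=> x y; rewrite /above => ->.
have -> : below g h = false by rewrite /below ltnNge ltnW.
have -> : above g h by rewrite /above ltnW.
have -> : below h (conj_tr h g) by rewrite /below c1.
have -> : above h (conj_tr h g) = false by rewrite /above c1 leqNgt gh.
rewrite (below_above _ (ltnW gh)) cats0.
have cb : {in map (conj_tr (conj_tr h g)) (filter (below g) s), forall x, below g x}.
  move=> _ /mapP[x xs ->]; rewrite -eb in xs.
  by have [_ + _ e] := conj_tr_below cP sP xs; rewrite /below e c1.
rewrite (_ : filter (below h) (map _ _)
           = map (conj_tr (conj_tr h g)) (filter (below g) s)); last first.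
  by apply/all_filterP/allP => x /cb; rewrite /below => /ltn_trans ->.
rewrite (_ : filter (above h) (map _ _) = [::]); last first.
  apply/eqP; rewrite -[_ == _]negbK -has_filter; apply/hasPn => x /cb.
  by rewrite /below /above -ltnNge => /ltn_trans ->.
rewrite map_cat /= conj_trK // -!map_comp -catA /=; congr (_ ++ _ :: _ ++ _ :: _).
- apply/eq_in_map => x; rewrite mem_filter => /andP[xg /(allP sP) xP] /=.
  by rewrite conj_tr_conj.
- by congr map; rewrite -!filter_predI; apply: eq_filter => x /=; rewrite andbC.
- by rewrite -[RHS]ehi -!filter_predI; apply: eq_filter => x /=; rewrite andbC.
Qed.

Lemma proper_gen_act l s : all proper_tr s -> all proper_tr (gen_act l s).
Proof.
elim: l s => [|l IH] [|g s] //=; last by move=> /andP[-> /IH].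
case: s => [|h s] //= /and3P[gP hP sP]; case: eqP => [_|ne] /=; first by rewrite gP hP.
case: ltnP => gh /=; first by rewrite hP sP proper_conj_tr.
rewrite gP sP proper_conj_tr // ltn_neqAle gh andbT.
by apply/eqP => e; apply: ne; apply: val_inj.
Qed.

Lemma hurwitz_sort_gen_act l s : all proper_tr s ->
  hurwitz_sort (gen_act l s) = hurwitz_sort s.
Proof.
elim: l s => [|l IH] [|g s] //=; last by move=> /andP[gP /IH->].
case: s => [|h s] //= /and3P[gP hP sP]; case: eqP => [//|ne].
have NP := proper_hurwitz_sort sP.
case: ltnP => gh /=; first by rewrite -insert_trC.
have {}gh : h.1 < g.1.
  by rewrite ltn_neqAle gh andbT; apply/eqP => e; apply: ne; apply: val_inj.
(* [insert_trC] applies to the pair [conj_tr g h], [g]; the second conjugation by [g] gives back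
   [h]. *)
by rewrite insert_trC ?conj_trK ?proper_conj_tr ?fst_conj_tr.
Qed.

Lemma fst_gen_act l s : all proper_tr s ->
  map fst (gen_act l s) = swap_at l (map fst s).
Proof.
elim: l s => [|l IH] [|g s] //=; last by move=> /andP[_ /IH<-].
case: s => [|h s] //= /and3P[gP hP sP]; case: eqP => [/= -> //|ne].
case: ltnP => gh /=; first by rewrite fst_conj_tr.
rewrite fst_conj_tr // ltn_neqAle gh andbT.
by apply/eqP => e; apply: ne; apply: val_inj.
Qed.

Lemma act_word_spec w s : all proper_tr s ->
  [/\ all proper_tr (act_word w s), hurwitz_sort (act_word w s) = hurwitz_sort s
    & map fst (act_word w s) = foldr (@swap_at _) (map fst s) w].
Proof.
move=> sP; elim: w => //= l w [wP eN ef].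
by rewrite proper_gen_act // hurwitz_sort_gen_act // fst_gen_act // ef.
Qed.

End Hurwitz.

(** * Cycle counts under multiplication by a transposition *)

Lemma card_porbits_mul_tperm_r (T : finType) (s : {perm T}) (x y : T) :
  #|porbits (s * tperm x y)| + (x \notin porbit s y).*2 = #|porbits s| + (x != y).
Proof.
rewrite -(porbitsV (s * _)) invMg tpermV -(porbitsV s) -(porbitV s).
exact: porbits_mul_tperm.
Qed.

Lemma porbit_stable (T : finType) (s : {perm T}) (P : pred T) (x y : T) :
  (forall z, P z -> P (s z)) -> y \in porbit s x -> P x -> P y.
Proof.
move=> sP /porbitP[i ->] Px; elim: i => [|i IH]; first by rewrite expg0 perm1.
by rewrite expgSr permM; apply: sP.
Qed.

Lemma card_porbits1 (T : finType) : #|porbits (1%g : {perm T})| = #|T|.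
Proof.
rewrite card_imset // => x y exy.
have : y \in porbit 1 x by rewrite exy porbit_id.
by case/porbitP=> i ->; rewrite expg1n perm1.
Qed.

(** * Nested intervals and prefixes of minimal factorisations *)

Section Noncrossing.
Variable n : nat.
Implicit Types (t x y : transp n) (s : seq (transp n)).

(** Here [x] stands before [t]: the interval [[x.1, x.2)] contains both endpoints of [t] or neither.
    The strict inequality makes the larger endpoints of a noncrossing sequence distinct. *)
Definition nested x t := (x.1 <= t.1) && ((x.2 <= t.1) || (t.2 < x.2)).

Definition noncrossing s := all (@proper_tr n) s && pairwise nested s.

(* As permutations compose left to right here, this is tau_k o ... o tau_1 o c. *)
Definition complement s : {perm 'I_n} := (cshift n * (prod_tr s)^-1)%g.

Lemma prod_tr_rcons s t : prod_tr (rcons s t) = (tr t * prod_tr s)%g.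
Proof. by rewrite -cats1 prod_tr_cat /= /rcomp mul1g. Qed.

Lemma complement_rcons s t : complement (rcons s t) = (complement s * tr t)%g.
Proof. by rewrite /complement prod_tr_rcons invMg /tr tpermV mulgA. Qed.

Lemma prod_tr_fix s (y : 'I_n) :
  {in s, forall t, (t.1 != y) && (t.2 != y)} -> prod_tr s y = y.
Proof.
elim: s => /= [|t s IH] H; first by rewrite perm1.
rewrite /rcomp permM IH => [|u us]; last by apply: H; rewrite inE us orbT.
by rewrite /tr; have /andP[? ?] := H t (mem_head _ _); rewrite tpermD.
Qed.

(** The cycle sends [x] to [x + 1], which no transposition of [s] moves: first endpoints are at most
    [i <= x], and second endpoints avoid it. *)
Lemma complement_succ s (i x : 'I_n) : x.+1 < n -> i <= x ->
  {in s, forall t, (t.1 <= i) && (t.2 != x.+1 :> nat)} ->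
  complement s x = x.+1 :> nat.
Proof.
move=> xn ix H; rewrite permM [cshift n x]permE.
have ex : ordS x = x.+1 :> nat by rewrite /= modn_small.
rewrite -[in RHS]ex; congr (nat_of_ord _); apply: (@perm_inj _ (prod_tr s)).
rewrite permKV prod_tr_fix // => t /H /andP[ti tx]; apply/andP; split.
  by apply/eqP => e; move: ti; rewrite e ex; lia.
by apply: contraNneq tx => ->; rewrite ex.
Qed.

(** No endpoint lies in [(i, j]], so the complement walks from [i] to [j] by unit steps. *)
Lemma complement_path s (i j : 'I_n) : i <= j ->
  {in s, forall t, (t.1 <= i) && ((t.2 <= i) || (j < t.2))} ->
  j \in porbit (complement s) i.
Proof.
move=> ij H; suff P d : i + d <= j -> (complement s ^+ d)%g i = i + d :> nat.
  apply/porbitP; exists (j - i); apply: val_inj.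
  by rewrite /= P subnKC.
elim: d => [|d IH] le_dj; first by rewrite expg0 perm1 addn0.
have e : (complement s ^+ d)%g i = i + d :> nat by rewrite IH //; lia.
rewrite expgSr permM (@complement_succ _ i) ?e ?addnS //.
- by have := ltn_ord j; lia.
- by lia.
- by move=> t /H; lia.
Qed.

(** Before [u] is appended, the complement is the successor map on [[u.1, u.2)], and multiplying by
    [u] closes this run into a cycle. The interval of an older [t] stays invariant because it holds
    both endpoints of [u] or neither. *)
Lemma complement_stable s t (x : 'I_n) : noncrossing s -> t \in s ->
  t.1 <= x < t.2 -> t.1 <= complement s x < t.2.
Proof.
move=> /andP[]; elim/last_ind: s t x => // s u IH t x.
rewrite all_rcons pairwise_rcons complement_rcons permM => /andP[uP sP] /andP[us sN].
rewrite mem_rcons inE => /orP[/eqP->|ts] xt.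
  have e : complement s x = x.+1 :> nat.
    apply: (@complement_succ _ u.1); first by have := ltn_ord u.2; lia.
      by case/andP: xt.
    by move=> y /(allP us); rewrite /nested; lia.
  move: uP xt e; rewrite /proper_tr /tr; case: tpermP => [->|_|_ ne2]; [lia..|].
  by move/eqP: ne2; rewrite -(inj_eq val_inj) /=; lia.
have := IH t x sP sN ts xt; move: (allP us t ts) uP; rewrite /nested /proper_tr.
by rewrite /tr; case: tpermP => [->|->|//]; lia.
Qed.

Lemma card_porbits_cshift : 0 < n -> #|porbits (cshift n)| = 1.
Proof.
move=> n0; pose o := Ordinal n0; rewrite -(cards1 (porbit (cshift n) o)).
congr #|pred_of_set _|; apply/setP=> X; rewrite inE; apply/imsetP/eqP => [[x _ ->]|->].
  apply/eqP; rewrite eq_porbit_mem.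
  have := @complement_path [::] o x (leq0n _); rewrite /complement invg1 mulg1.
  exact.
by exists o.
Qed.

Lemma card_complement_rcons s t : t.1 != t.2 ->
  #|porbits (complement (rcons s t))| + (t.1 \notin porbit (complement s) t.2).*2
  = #|porbits (complement s)|.+1.
Proof. by move=> ne; rewrite complement_rcons card_porbits_mul_tperm_r ne addn1. Qed.

Lemma proper_neq t : proper_tr t -> t.1 != t.2.
Proof. by rewrite /proper_tr -(inj_eq val_inj) /=; case: ltngtP. Qed.

(** The long cycle has one orbit and each factor adds at most one, so equality forces every factor
    to split a cycle. *)
Lemma card_complement_le s : 0 < n -> all (@proper_tr n) s ->
  #|porbits (complement s)| <= (size s).+1.
Proof.
move=> n0; elim/last_ind: s => [|s t IH].
  by rewrite /complement invg1 mulg1 card_porbits_cshift.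
rewrite all_rcons size_rcons => /andP[/proper_neq ne /IH].
by have := card_complement_rcons s ne; lia.
Qed.

(** At the maximal count every [t] splits a cycle of the complement of its predecessors, so its
    endpoints share an orbit. By [complement_stable] this orbit cannot leave an interval
    [[x.1, x.2)] that contains [t.1]. *)
Lemma complement_noncrossing s : 0 < n -> all (@proper_tr n) s ->
  pairwise (@fst_le n) s -> #|porbits (complement s)| = (size s).+1 ->
  noncrossing s.
Proof.
move=> n0 sP; rewrite /noncrossing sP /=; elim/last_ind: s sP => // s t IH.
rewrite all_rcons !pairwise_rcons size_rcons => /andP[tP sP] /andP[ts sS] card_st.
have := card_complement_rcons s (proper_neq tP).
have := card_complement_le n0 sP; rewrite card_st => le_s.
(* A merge would require [size s + 3] orbits beforehand, above the bound. *)
case: (boolP (_ \in _)) => [orb|_] /= e; last by exfalso; move: le_s e; set a := #|_|; lia.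
have sN : pairwise nested s by apply: IH => //; lia.
rewrite sN andbT; apply/allP => x xs; rewrite /nested; have := allP ts x xs.
rewrite /fst_le => -> /=; case: (leqP x.2 t.1) => //= xt.
have st : noncrossing s by apply/andP.
rewrite porbit_sym in orb.
have := @porbit_stable _ _ (fun z : 'I_n => x.1 <= z < x.2) _ _
  (fun z => @complement_stable s x z st xs) orb.
by rewrite /= xt andbT => /(_ (allP ts x xs)) /andP[].
Qed.

(** Nesting lets [complement_path] join the endpoints of each new transposition, so every factor
    splits a cycle. *)
Lemma noncrossing_complement s : 0 < n -> noncrossing s ->
  #|porbits (complement s)| = (size s).+1.
Proof.
move=> n0 /andP[]; elim/last_ind: s => [|s t IH].
  by rewrite /complement invg1 mulg1 card_porbits_cshift.
rewrite all_rcons pairwise_rcons size_rcons => /andP[tP sP] /andP[ts sN].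
have := card_complement_rcons s (proper_neq tP).
rewrite IH // porbit_sym complement_path; first by rewrite /= addn0.
- exact: ltnW.
- by move=> x /(allP ts).
Qed.

Lemma noncrossing_prod s : noncrossing s -> #|porbits (prod_tr s)| + size s = n.
Proof.
move=> /andP[]; elim/last_ind: s => [|s t IH].
  by rewrite /= card_porbits1 card_ord addn0.
rewrite all_rcons pairwise_rcons size_rcons => /andP[tP sP] /andP[ts sN].
have : #|porbits (prod_tr (rcons s t))| + (t.1 \notin porbit (prod_tr s) t.2).*2
     = #|porbits (prod_tr s)| + (t.1 != t.2).
  by rewrite prod_tr_rcons; apply: porbits_mul_tperm.
rewrite (proper_neq tP); have := IH sP sN.
(* No earlier transposition moves t.2, so the new factor merges two cycles. *)
have fix2 : prod_tr s t.2 = t.2.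
  apply: prod_tr_fix => x xs; have := allP ts x xs; move: tP.
  by rewrite /nested /proper_tr -!(inj_eq val_inj) /=; lia.
have -> : t.1 \notin porbit (prod_tr s) t.2.
  apply/negP => /(@porbit_stable _ _ (pred1 t.2)) H.
  have /eqP e : pred1 t.2 t.1 by apply: H => //= z /eqP ->; rewrite fix2.
  by move: (proper_neq tP); rewrite e eqxx.
set a := #|_|; set b := #|_|; rewrite /=; lia.
Qed.

Lemma card_porbits_le (p : {perm 'I_n}) : #|porbits p| <= n.
Proof. by rewrite -[X in _ <= X]card_ord; apply: leq_imset_card. Qed.

(** Since [|c| = n - 1], the order condition says that the complement has length [n - 1 - k], that
    is, [k + 1] cycles. *)
Lemma SigmaP k s : 0 < n -> Sigma k s ->
  [/\ size s = k, all (@proper_tr n) s & #|porbits (complement s)| = k.+1].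
Proof.
move=> n0 /and4P[/eqP sk sP /eqP e]; rewrite /pleq e /pabs /rcomp.
rewrite card_porbits_cshift // -/(complement s) => /eqP.
(* The bound by [n] makes the truncated subtraction in [pabs] exact. *)
by have := card_porbits_le (complement s); split=> //; lia.
Qed.

Lemma Sigma_noncrossing k s : 0 < n -> pairwise (@fst_le n) s ->
  Sigma k s -> noncrossing s.
Proof.
by move=> n0 sS /(SigmaP n0)[sk sP e]; apply: complement_noncrossing; rewrite ?sk.
Qed.

Lemma noncrossing_Sigma s : 0 < n -> noncrossing s -> Sigma (size s) s.
Proof.
move=> n0 sN; have := noncrossing_prod sN; have := noncrossing_complement n0 sN.
have /andP[sP _] := sN; rewrite /Sigma eqxx [all _ _]sP /pleq /pabs /rcomp /=.
rewrite card_porbits_cshift // -/(complement s) => -> e.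
by have := card_porbits_le (complement s); rewrite noncrossing_complement //; lia.
Qed.

Lemma Sigma_same_prod k s s' : size s = size s' -> all (@proper_tr n) s' ->
  prod_tr s = prod_tr s' -> Sigma k s -> Sigma k s'.
Proof. by rewrite /Sigma => -> -> -> /and4P[-> _ -> ->]. Qed.

End Noncrossing.

(** * Rearrangements as words of adjacent swaps *)

Section Words.
Variable T : eqType.
Implicit Types (s t : seq T) (w : seq nat).

Lemma size_swap_at l s : size (swap_at l s) = size s.
Proof. by elim: l s => [|l IH] [|x s] //=; [case: s | rewrite IH]. Qed.

Lemma nth_swap_at x0 l s i : l.+1 < size s ->
  nth x0 (swap_at l s) i
  = nth x0 s (if i == l then l.+1 else if i == l.+1 then l else i).
Proof.
elim: l s i => [|l IH] [|x s] //=; first by case: s => // y s [|[|i]].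
by move=> [|i] ls //=; rewrite IH // !eqSS; case: eqP => // _; case: eqP.
Qed.

Lemma foldr_swap_cons x s w :
  foldr (@swap_at T) (x :: s) (map S w) = x :: foldr (@swap_at T) s w.
Proof. by elim: w => //= l w ->. Qed.

(** [foldr] applies the last letter first, so [x] travels left from position [size s] to position
    0. *)
Lemma foldr_swap_front x s s' :
  foldr (@swap_at T) (s ++ x :: s') (iota 0 (size s)) = x :: s ++ s'.
Proof. by elim: s => //= y s IH; rewrite (iotaDl 1) foldr_swap_cons IH. Qed.

Lemma perm_swap_word s t : perm_eq s t ->
  exists2 w, valid_word (size s) w & foldr (@swap_at T) s w = t.
Proof.
elim: t s => [|x t IH] s st; first by exists [::]; rewrite // (perm_nilP st).
have xs : x \in s by rewrite (perm_mem st) mem_head.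
move: st; case/splitPr: xs => s1 s2; rewrite perm_catC /= perm_cons perm_catC.
(* The [iota] block, acting first, brings the head of the target to the front; the shifted word then
   rearranges the tail. *)
case/IH => w wV <-; exists (map S w ++ iota 0 (size s1)).
  rewrite /valid_word all_cat all_map; apply/andP; split.
    by apply: sub_all wV => l /=; rewrite !size_cat /= addnS.
  by apply/allP => l; rewrite mem_iota size_cat /=; lia.
by rewrite foldr_cat foldr_swap_front foldr_swap_cons.
Qed.

Lemma perm_seq_act_gen k l (x : k.-tuple T) : l.+1 < k ->
  perm_seq_act (gen_perm k l) x = swap_at l x :> seq T.
Proof.
move=> lk; have [x0 _|e] := pickP (fun _ : 'I_k => true); last first.
  by have := e (Ordinal lk).
have lk' := ltnW lk; pose d := tnth x x0.
apply: (@eq_from_nth _ d); first by rewrite size_swap_at !size_tuple.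
move=> i; rewrite size_tuple => ik; rewrite nth_swap_at ?size_tuple //.
rewrite -[i]/(nat_of_ord (Ordinal ik)) -tnth_nth tnth_mktuple (tnth_nth d).
congr nth; rewrite /gen_perm !insubT tpermV /=.
case: tpermP => [[->]|[->]|]; rewrite ?eqxx //=.
  by case: eqP => //; lia.
move=> /eqP; rewrite -(inj_eq val_inj) /= => /negPf-> /eqP.
by rewrite -(inj_eq val_inj) /= => /negPf->.
Qed.

Lemma perm_seq_actM k (p q : {perm 'I_k}) (x : k.-tuple T) :
  perm_seq_act (p * q)%g x = perm_seq_act q (perm_seq_act p x).
Proof. by apply: eq_from_tnth => i; rewrite !tnth_mktuple invMg permM. Qed.

Lemma perm_seq_act1 k (x : k.-tuple T) : perm_seq_act 1%g x = x.
Proof. by apply: eq_from_tnth => i; rewrite tnth_mktuple invg1 perm1. Qed.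

Lemma perm_seq_act_word k w (x : k.-tuple T) : valid_word k w ->
  perm_seq_act (word_perm k w) x = foldr (@swap_at T) x w :> seq T.
Proof.
elim: w => [_|l w IH /andP[lk wk]]; first exact: (congr1 val (perm_seq_act1 x)).
by rewrite [word_perm k _]/= perm_seq_actM perm_seq_act_gen // IH.
Qed.

End Words.

(** * The parking process *)

Section ParkingTheory.
Variable n : nat.
Implicit Types (R O : {set 'I_n}) (e p x y : 'I_n) (E : seq 'I_n).

Lemma cpowE m x : cpow n m x = (x + m) %% n :> nat.
Proof.
elim: m => [|m IH]; first by rewrite /cpow expg0 perm1 addn0 modn_small.
by rewrite /cpow expgSr permM [cshift n _]permE /= IH -addn1 modnDml addn1 addnS.
Qed.

Lemma cpowD m m' x : cpow n m (cpow n m' x) = cpow n (m' + m) x.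
Proof. by rewrite /cpow expgD permM. Qed.

Lemma cpow_mod m m' x : m = m' %[mod n] -> cpow n m x = cpow n m' x.
Proof. by move=> e; apply: val_inj; rewrite /= !cpowE -modnDmr e modnDmr. Qed.

Lemma cpow_trans x y : exists2 m, 0 < m <= n & cpow n m x = y.
Proof.
have xn := ltn_ord x; have yn := ltn_ord y.
have [xy|yx] := ltnP x y; [exists (y - x) | exists (n + y - x)]; try lia;
  apply: val_inj; rewrite /= cpowE.
- by rewrite subnKC ?modn_small // ltnW.
- by rewrite (_ : x + _ = y + n) ?modnDr ?modn_small //; lia.
Qed.

Lemma park_stepP R e : R != set0 ->
  exists m, [/\ 0 < m <= n, park_step R e = cpow n m e, cpow n m e \in R
    & forall m', 0 < m' < m -> cpow n m' e \notin R].
Proof.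
case/set0Pn => y yR; have [m /andP[m0 mn] em] := cpow_trans e y.
pose a s := cpow n s.+1 e \in R; have ha : has a (iota 0 n).
  by apply/hasP; exists m.-1; rewrite ?mem_iota /a ?prednK ?em //; lia.
have lt_f : find a (iota 0 n) < n by move: ha; rewrite has_find size_iota.
exists (find a (iota 0 n)).+1; split=> //.
- by have := nth_find 0 ha; rewrite nth_iota.
- move=> [|m'] // /andP[_ lt_m']; have := before_find 0 lt_m'.
  by rewrite nth_iota ?add0n /a => [->|]; lia.
Qed.

Lemma park_step_in R e : R != set0 -> park_step R e \in R.
Proof. by case/(park_stepP e) => m [_ ->]. Qed.

Lemma park_step_eq R e m : 0 < m -> cpow n m e \in R ->
  (forall m', 0 < m' < m -> cpow n m' e \notin R) -> park_step R e = cpow n m e.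
Proof.
move=> m0 mR min; have R0 : R != set0 by apply/set0Pn; exists (cpow n m e).
have [m1 [/andP[m10 _] -> m1R min1]] := park_stepP e R0.
have [lt|lt|-> //] := ltngtP m m1.
  by have := min1 m; rewrite m0 lt mR => /(_ isT).
by have := min m1; rewrite m10 lt m1R => /(_ isT).
Qed.

Lemma park_step_sub R R' e : R' \subset R -> park_step R e \in R' ->
  park_step R' e = park_step R e.
Proof.
move=> sR pR'; have R0 : R != set0 by apply/set0Pn; exists (park_step R e); apply: (subsetP sR).
have [m [/andP[m0 _] em _ min]] := park_stepP e R0; rewrite em in pR' *.
by apply: park_step_eq => // m' /min; apply: contra; apply: (subsetP sR).
Qed.

(** Neither the first free spot of [R] nor any point passed before it lies in [R'], so the search in
    [R'] may restart from that spot. *)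
Lemma park_step_skip R R' e : R' \subset R -> R != set0 -> R' != set0 ->
  park_step R e \notin R' -> park_step R' e = park_step R' (park_step R e).
Proof.
move=> sR R0 R'0; have [m [/andP[m0 _] -> _ min]] := park_stepP e R0 => pR'.
have [m1 [/andP[m10 _] -> m1R min1]] := park_stepP (cpow n m e) R'0.
rewrite cpowD in m1R *; apply: park_step_eq => // [|m' /andP[m'0 m'lt]]; first by lia.
have [lt|lt|-> //] := ltngtP m' m.
  by apply: (contra (subsetP sR _)); apply: min; rewrite m'0.
have := min1 (m' - m); rewrite cpowD subnKC; last exact: ltnW.
by apply; lia.
Qed.

(** Recording only the spots left over makes the result invariant under reordering [E], unlike
    [park]. *)
Definition free_spots O E := foldr (fun e R => R :\ park_step R e) O E.

Lemma free_spotsE O E : O :\: [set x | x \in park O E] = free_spots O E.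
Proof.
elim: E => /= [|e E IH]; first by apply/setP => x; rewrite !inE.
by rewrite -IH; apply/setP => x; rewrite !inE negb_or andbA.
Qed.

(* The abelian property of parking. *)
Lemma park_step_comm R e e' :
  let R1 := R :\ park_step R e in let R2 := R :\ park_step R e' in
  R1 :\ park_step R1 e' = R2 :\ park_step R2 e.
Proof.
have [->|R0] := eqVneq R set0; first by rewrite /= !set0D.
move=> R1 R2; have sR1 : R1 \subset R by apply: subsetDl.
have sR2 : R2 \subset R by apply: subsetDl.
(* If both cars aim at the same spot, whichever comes second continues from there; otherwise neither
   disturbs the other. *)
have [epp|ne] := eqVneq (park_step R e) (park_step R e').
  have e12 : R1 = R2 by rewrite /R1 epp.
  rewrite -e12; have [->|R10] := eqVneq R1 set0; first by rewrite !set0D.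
  have out : park_step R e \notin R1 by rewrite !inE eqxx.
  have s1 := park_step_skip sR1 R0 R10 out; rewrite epp in out.
  by rewrite s1 (park_step_skip sR1 R0 R10 out) epp.
have -> : park_step R1 e' = park_step R e'.
  by apply: park_step_sub; rewrite // !inE eq_sym ne park_step_in.
have -> : park_step R2 e = park_step R e.
  by apply: park_step_sub; rewrite // !inE ne park_step_in.
by apply/setP => x; rewrite !inE; case: (_ == _); case: (_ == _).
Qed.

Lemma free_spots_perm O E E' : perm_eq E E' -> free_spots O E = free_spots O E'.
Proof.
elim: E E' => [|e E IH] E' /=; first by rewrite perm_sym => /perm_nilP ->.
move=> EE'; have eE' : e \in E' by rewrite -(perm_mem EE') mem_head.
case/splitPr: eE' EE' => E1 E2; rewrite perm_sym perm_catC /= perm_cons perm_catC.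
rewrite perm_sym => /IH ->; elim: E1 => //= x E1 <-.
exact: park_step_comm.
Qed.

Lemma card_free_spots O E : size E <= #|O| -> #|free_spots O E| = #|O| - size E.
Proof.
elim: E => /= [|e E IH] sE; first by rewrite subn0.
have c := IH (ltnW sE); have R0 : free_spots O E != set0 by rewrite -card_gt0 c subn_gt0.
have := cardsD1 (park_step (free_spots O E) e) (free_spots O E).
by rewrite park_step_in // c subnS => ->.
Qed.

Lemma free_spots1 O E : #|O| = (size E).+1 -> exists v, free_spots O E = [set v].
Proof. by move=> cO; apply/cards1P; rewrite card_free_spots cO ?subSnn. Qed.

Lemma residue1 O E v : free_spots O E = [set v] -> residue O E = Some v.
Proof.
move=> e; rewrite /residue free_spotsE e.
by case: pickP => [x /set1P -> //|/(_ v)]; rewrite inE eqxx.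
Qed.

Lemma park_step_shift m R e :
  park_step (shiftB m R) (cpow n m e) = cpow n m (park_step R e).
Proof.
rewrite /park_step [RHS]cpowD addnC -[RHS]cpowD; congr (cpow n _.+1 _).
apply: eq_find => s; rewrite cpowD addnC -cpowD mem_imset //.
exact: perm_inj.
Qed.

Lemma shiftB_set1 m x : shiftB m [set x] = [set cpow n m x].
Proof. exact: imset_set1. Qed.

Lemma shiftBD1 m R x : shiftB m (R :\ x) = shiftB m R :\ cpow n m x.
Proof.
rewrite -shiftB_set1 /shiftB; apply/setP => y; rewrite -[y](permKV (cpow n m)).
by rewrite inE !mem_imset ?inE //; apply: perm_inj.
Qed.

Lemma free_spots_shift m O E :
  free_spots (shiftB m O) (map (cpow n m) E) = shiftB m (free_spots O E).
Proof. by elim: E => //= e E ->; rewrite park_step_shift shiftBD1. Qed.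

Lemma card_shiftB m O : #|shiftB m O| = #|O|.
Proof. by apply: card_imset; apply: perm_inj. Qed.

Lemma size_park O E : size (park O E) = size E.
Proof. by elim: E => //= e E ->. Qed.

Lemma park_sub O E : size E <= #|O| -> {subset park O E <= O}.
Proof.
elim: E => //= e E IH sE x; rewrite inE free_spotsE => /orP[/eqP->|]; last first.
  exact/IH/ltnW.
have R0 : free_spots O E != set0.
  by rewrite -card_gt0 card_free_spots ?subn_gt0 ?(ltnW sE).
by have := park_step_in e R0; rewrite -free_spotsE inE => /andP[].
Qed.

Lemma park_set O E : size E <= #|O| -> O = free_spots O E :|: [set x | x \in park O E].
Proof.
move=> /park_sub sP; rewrite -free_spotsE; apply/setP => x; rewrite !inE.
by case: (boolP (x \in park O E)) => [/sP ->|_]; rewrite ?orbT ?orbF.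
Qed.

Lemma park_step_next R e p : p \in R -> e < p ->
  {in R, forall y, ~~ (e < y < p)} -> park_step R e = p.
Proof.
move=> pR ep out; have pn := ltn_ord p.
have ec m : 0 < m <= p - e -> cpow n m e = e + m :> nat.
  by move=> ?; rewrite cpowE modn_small //; lia.
have e1 : cpow n (p - e) e = p by apply: val_inj; rewrite /= ec; lia.
rewrite (@park_step_eq _ _ (p - e)) ?e1 // ?subn_gt0 // => m' m'lt.
by apply/negP => /out; rewrite ec; lia.
Qed.

(** A car that wraps around must meet the free point [o], so a car not parked at [o] stops before
    wrapping. *)
Lemma park_nowrap R e (o : 'I_n) : o = 0 :> nat -> o \in R -> park_step R e != o ->
  e < park_step R e /\ {in R, forall y, ~~ (e < y < park_step R e)}.
Proof.
move=> o0 oR; have R0 : R != set0 by apply/set0Pn; exists o.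
have en := ltn_ord e; have [m [/andP[m0 mn] -> mR min]] := park_stepP e R0 => neo.
have eo : cpow n (n - e) e = o.
  by apply: val_inj; rewrite /= cpowE subnKC ?modnn // ltnW.
have lt_m : m < n - e.
  rewrite ltnNge leq_eqVlt; apply/negP => /orP[/eqP e1|lt].
    by move: neo; rewrite -e1 eo eqxx.
  by have := min (n - e); rewrite eo oR subn_gt0 en lt => /(_ isT).
have em : cpow n m e = e + m :> nat by rewrite cpowE modn_small //; lia.
rewrite em; split=> [|y yR]; first by lia.
apply/negP => lt_y; have := min (y - e).
have -> : cpow n (y - e) e = y.
  by apply: val_inj; rewrite /= cpowE subnKC ?modn_small //; lia.
by rewrite yR => H; apply/notF/H; lia.
Qed.

Lemma park_pairs O E (o : 'I_n) : o = 0 :> nat -> o \in free_spots O E ->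
  {in zip E (park O E), forall t : transp n, t.1 < t.2 /\
     {in free_spots O E, forall y, ~~ (t.1 < y <= t.2)}}.
Proof.
move=> o0; elim: E => //= e E IH; rewrite free_spotsE in_setD1 => /andP[neo oR] t.
rewrite inE => /orP[/eqP->|tE] /=.
  rewrite eq_sym in neo; have [lt out] := park_nowrap o0 oR neo.
  split=> // y /setD1P[/eqP ny /out]; apply: contra => /andP[-> ].
  by rewrite leq_eqVlt => /orP[/eqP/val_inj|].
have [lt out] := IH oR t tE; split=> // y /setD1P[_]; exact: out.
Qed.

(** The spot of the head car is still free once the tail has parked. No tail car has passed or taken
    it, so it lies outside each [(t.1, t.2]], which is nesting. *)
Lemma park_noncrossing O E (o : 'I_n) : o = 0 :> nat -> o \in free_spots O E ->
  pairwise (fun x y : 'I_n => x <= y) E -> noncrossing (zip E (park O E)).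
Proof.
move=> o0 oE ES; apply/andP; split.
  by apply/allP => t /(park_pairs o0 oE)[].
elim: E oE ES => //= e E IH; rewrite free_spotsE in_setD1 => /andP[neo oR] /andP[eE ES].
rewrite IH // andbT; apply/allP => t tE; rewrite /nested /=.
have R0 : free_spots O E != set0 by apply/set0Pn; exists o.
have tE1 : t.1 \in E.
  by rewrite -[E](@unzip1_zip _ _ E (park O E)) ?size_park //; apply: map_f.
have [_ out] := park_pairs o0 oR tE.
have := out _ (park_step_in e R0); rewrite (allP eE _ tE1) /=.
by rewrite negb_and -leqNgt -ltnNge.
Qed.

Lemma noncrossing_cons (t : transp n) s : noncrossing (t :: s) ->
  [/\ proper_tr t, all (nested t) s, noncrossing s & t.2 \notin map snd s].
Proof.
case/andP => /= /andP[tP sP] /andP[ts sN]; split=> //; first exact/andP.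
apply/negP => /mapP[x xs e]; have := allP ts x xs; have := allP sP x xs.
by rewrite /nested /proper_tr e; lia.
Qed.

(** Converse of [park_noncrossing]: if the spare spots avoid all intervals, each car finds its own
    larger endpoint as the next free spot. *)
Lemma noncrossing_park O (s : seq (transp n)) : noncrossing s ->
  {subset map snd s <= O} ->
  {in O, forall y, y \notin map snd s -> {in s, forall t : transp n, ~~ (t.1 < y < t.2)}} ->
  park O (map fst s) = map snd s.
Proof.
elim: s => //= t s IH /noncrossing_cons[tP ts sN ut] sO out.
rewrite IH // => [|x xs|y yO ys x xs]; last 2 first.
- by apply: sO; rewrite inE xs orbT.
(* The tail parks in the same [O], where [t.2] is now a spare spot; nesting keeps it out of the
   intervals of [s]. *)
- have [->|ny] := eqVneq y t.2.
    by have := allP ts x xs; rewrite /nested; lia.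
  by apply: out; rewrite // ?inE ?negb_or ?ny ?xs ?orbT.
congr (_ :: _); apply: park_step_next => //.
  by rewrite !inE ut sO // mem_head.
move=> y; rewrite !inE => /andP[ys yO].
have [->|ny] := eqVneq y t.2; first by rewrite ltnn andbF.
by apply: out; rewrite ?mem_head // inE negb_or ny.
Qed.

Lemma noncrossing_uniq (s : seq (transp n)) : noncrossing s -> uniq (map snd s).
Proof. by elim: s => //= t s IH /noncrossing_cons[_ _ /IH -> ->]. Qed.

Lemma noncrossing_sorted (s : seq (transp n)) : noncrossing s -> pairwise (@fst_le n) s.
Proof. by case/andP=> _; apply: sub_pairwise => x y /andP[]. Qed.

End ParkingTheory.

(** * The map [Gamma], its fibres and the count *)

Section Gamma.
Variables (n k : nat) (o : 'I_n) (o0 : o = 0 :> nat).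
Implicit Types (A : k.-tuple 'I_n) (B : {set 'I_n}) (g : seq (transp n)).

Let n_gt0 : 0 < n. Proof. by rewrite -[0]o0 ltn_ord. Qed.

Lemma shiftA_comp m m' A : shiftA m (shiftA m' A) = shiftA (m' + m) A.
Proof. by apply: eq_from_tnth => i; rewrite !tnth_map cpowD. Qed.

Lemma shiftB_comp m m' B : shiftB m (shiftB m' B) = shiftB (m' + m) B.
Proof. by rewrite /shiftB -imset_comp; apply: eq_imset => x /=; rewrite cpowD. Qed.

Lemma shiftA_mod m m' A : m = m' %[mod n] -> shiftA m A = shiftA m' A.
Proof. by move=> e; apply: eq_from_tnth => i; rewrite !tnth_map (cpow_mod _ e). Qed.

Lemma shiftB_mod m m' B : m = m' %[mod n] -> shiftB m B = shiftB m' B.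
Proof. by move=> e; apply: eq_imset => x; apply: cpow_mod. Qed.

Lemma cpow0 x : cpow n 0 x = x.
Proof. by rewrite /cpow expg0 perm1. Qed.

Lemma shiftA_n A : shiftA n A = A.
Proof.
rewrite (@shiftA_mod _ 0) ?modnn ?mod0n //.
by apply: eq_from_tnth => i; rewrite tnth_map cpow0.
Qed.

Lemma shiftB_n B : shiftB n B = B.
Proof.
rewrite (@shiftB_mod _ 0) ?modnn ?mod0n // /shiftB.
by rewrite (eq_imset _ cpow0) imset_id.
Qed.

Lemma rho_exp_le A B : rho_exp B A <= n.
Proof. by rewrite /rho_exp; case: residue => // v; apply: leq_subr. Qed.

Lemma free_spots_residue A B : #|B| = k.+1 -> exists v, free_spots B A = [set v].
Proof. by move=> cB; apply: free_spots1; rewrite cB size_tuple. Qed.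

Lemma rho_exp1 A B v : free_spots B A = [set v] -> rho_exp B A = n - v.
Proof. by move=> /residue1; rewrite /rho_exp => ->. Qed.

Lemma free_spots_shiftA m A B v : free_spots B A = [set v] ->
  free_spots (shiftB m B) (shiftA m A) = [set cpow n m v].
Proof. by move=> e; rewrite free_spots_shift e shiftB_set1. Qed.

Lemma free_spots_til A B : #|B| = k.+1 ->
  free_spots (Btil A B) (Atil A B) = [set o].
Proof.
move=> /(free_spots_residue A)[v ev]; rewrite /Btil /Atil (rho_exp1 ev).
rewrite (free_spots_shiftA _ ev); congr [set _]; apply: val_inj.
by rewrite /= cpowE subnKC ?modnn // ltnW.
Qed.

Lemma perm_Iseq A B : perm_eq (Iseq A B) (Atil A B).
Proof. by rewrite /Iseq /= perm_sort. Qed.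

Lemma sorted_Iseq A B : pairwise (fun x y : 'I_n => x <= y) (Iseq A B).
Proof.
rewrite -sorted_pairwise; last by move=> x y z; apply: leq_trans.
by apply: sort_sorted => x y; apply: leq_total.
Qed.

Lemma size_Jseq A B : size (Jseq A B) = size (Iseq A B).
Proof. exact: size_park. Qed.

Lemma fst_gamma0 A B : map fst (gamma0 A B) = Iseq A B.
Proof. by rewrite -/unzip1 unzip1_zip ?size_Jseq. Qed.

Lemma snd_gamma0 A B : map snd (gamma0 A B) = Jseq A B.
Proof. by rewrite -/unzip2 unzip2_zip ?size_Jseq. Qed.

Lemma size_gamma0 A B : size (gamma0 A B) = k.
Proof. by rewrite -(size_map fst) fst_gamma0 size_tuple. Qed.

Lemma free_spots_Iseq A B : #|B| = k.+1 ->
  free_spots (Btil A B) (Iseq A B) = [set o].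
Proof. by move=> cB; rewrite (free_spots_perm _ (perm_Iseq A B)) free_spots_til. Qed.

Lemma gamma0_noncrossing A B : #|B| = k.+1 -> noncrossing (gamma0 A B).
Proof.
move=> cB; apply: (park_noncrossing o0); last exact: sorted_Iseq.
by rewrite free_spots_Iseq ?set11.
Qed.

(** Recovers the normalised set from the image: occupied spots are larger endpoints, and the residue
    is [o]. *)
Lemma Btil_gamma0 A B : #|B| = k.+1 ->
  Btil A B = o |: [set x | x \in map snd (gamma0 A B)].
Proof.
move=> cB; rewrite snd_gamma0 [LHS](@park_set _ _ (Iseq A B)).
  by rewrite free_spots_Iseq.
by rewrite size_tuple card_shiftB cB.
Qed.

Lemma gamma0_Sigma A B : #|B| = k.+1 -> Sigma k (gamma0 A B).
Proof.
by move=> cB; have := noncrossing_Sigma n_gt0 (gamma0_noncrossing A cB); rewrite size_gamma0.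
Qed.

(** A description of the image without words or permutations; [hurwitz_sort_inj] makes it determine
    [g]. *)
Definition Gamma_rel A B g :=
  [/\ all (@proper_tr n) g, map fst g = Atil A B & hurwitz_sort g = gamma0 A B].

Lemma Gamma_rel_act A B w : #|B| = k.+1 -> valid_word k w ->
  perm_seq_act (word_perm k w) (Iseq A B) = Atil A B ->
  Gamma_rel A B (act_word w (gamma0 A B)).
Proof.
move=> cB wV wA; have gN := gamma0_noncrossing A cB; have /andP[gP _] := gN.
have [wP ws wf] := act_word_spec w gP; split=> //.
  by rewrite wf fst_gamma0 -perm_seq_act_word // wA.
by rewrite ws hurwitz_sort_id // noncrossing_sorted.
Qed.

Lemma sorting_word A B : exists2 w, valid_word k w &
  perm_seq_act (word_perm k w) (Iseq A B) = Atil A B.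
Proof.
have [w wV wA] := perm_swap_word (perm_Iseq A B); rewrite size_tuple in wV.
by exists w => //; apply: val_inj; rewrite /= -wA -perm_seq_act_word.
Qed.

Lemma Gamma_rel_inj A B g g' : Gamma_rel A B g -> Gamma_rel A B g' -> g = g'.
Proof.
by case=> gP gf gs [g'P g'f g's]; apply: hurwitz_sort_inj; rewrite ?gf ?gs.
Qed.

(** [Gamma_is] quantifies over all sorting words, so the forward direction needs one to exist
    ([sorting_word]); the backward direction is uniqueness in [Gamma_rel]. *)
Lemma Gamma_isP A B g : #|B| = k.+1 -> Gamma_is A B g <-> Gamma_rel A B g.
Proof.
move=> cB; split=> [gG|gR sigma w sA wV ew].
  have [w wV wA] := sorting_word A B.
  rewrite -(gG (word_perm k w)^-1%g w) ?invgK //; first exact: Gamma_rel_act.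
  by rewrite -wA -perm_seq_actM mulgV perm_seq_act1.
apply: Gamma_rel_inj gR; apply: Gamma_rel_act => //.
by rewrite ew -sA -perm_seq_actM mulgV perm_seq_act1.
Qed.

Lemma Gamma_rel_ex A B : #|B| = k.+1 -> exists g, Gamma_rel A B g.
Proof.
move=> cB; have [w wV wA] := sorting_word A B.
by exists (act_word w (gamma0 A B)); apply: Gamma_rel_act.
Qed.

Lemma Gamma_rel_Sigma A B g : #|B| = k.+1 -> Gamma_rel A B g -> Sigma k g.
Proof.
move=> cB [gP gf gs]; apply: Sigma_same_prod (gamma0_Sigma A cB) => //.
  by rewrite -gs size_hurwitz_sort.
by rewrite -gs prod_hurwitz_sort.
Qed.

(** The residue moves along with the shift, so the normalising shift cancels it; the exponents agree
    only modulo [n]. *)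
Lemma til_shift m A B : #|B| = k.+1 ->
  Atil (shiftA m A) (shiftB m B) = Atil A B /\
  Btil (shiftA m A) (shiftB m B) = Btil A B.
Proof.
move=> /(free_spots_residue A)[v ev]; rewrite /Atil /Btil (rho_exp1 ev).
rewrite (rho_exp1 (free_spots_shiftA m ev)) shiftA_comp shiftB_comp.
suff e : m + (n - cpow n m v) = n - v %[mod n].
  by rewrite (shiftA_mod _ e) (shiftB_mod _ e).
apply/eqP; rewrite -(eqn_modDr (cpow n m v)) -addnA subnK; last exact: ltnW.
by rewrite cpowE modnDmr addnA subnK ?(ltnW (ltn_ord v)) // addnC.
Qed.

Lemma gamma0_til A A' B B' : Atil A B = Atil A' B' -> Btil A B = Btil A' B' ->
  gamma0 A B = gamma0 A' B'.
Proof. by move=> eA eB; rewrite /gamma0 /Jseq /Iseq eA eB. Qed.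

Lemma Gamma_rel_fibre A A' B B' g g' : #|B| = k.+1 -> #|B'| = k.+1 ->
  Gamma_rel A B g -> Gamma_rel A' B' g' ->
  (g = g' <-> exists m : nat, A' = shiftA m A /\ B' = shiftB m B).
Proof.
move=> cB cB' gR gR'; split=> [e|[m [eA eB]]]; last first.
  have [tA tB] := til_shift m A cB; rewrite -eA -eB in tA tB.
  apply: Gamma_rel_inj gR _.
  by case: gR' => g'P g'f g's; split; rewrite // -?tA // g's; apply: gamma0_til.
case: gR gR' => gP gf gs [g'P g'f g's].
have tA : Atil A B = Atil A' B' by apply: val_inj; rewrite /= -gf -g'f e.
have tB : Btil A B = Btil A' B' by rewrite !Btil_gamma0 // -gs -g's e.
(* The first summand normalises [(A, B)], the second undoes the normalisation of [(A', B')]. *)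
exists (rho_exp B A + (n - rho_exp B' A')).
rewrite -shiftA_comp -shiftB_comp -/(Atil A B) -/(Btil A B) tA tB.
by rewrite shiftA_comp shiftB_comp subnKC ?rho_exp_le // shiftA_n shiftB_n.
Qed.

Definition spots g : {set 'I_n} := o |: [set x | x \in map snd (hurwitz_sort g)].

(** The sorted form of [g] is nested, so parking its first endpoints in [spots g] returns its second
    endpoints and leaves [o]. With residue [o] the normalising shift is by [n], hence trivial. *)
Lemma spots_Sigma g : Sigma k g ->
  [/\ #|spots g| = k.+1, free_spots (spots g) (map fst g) = [set o]
    & forall A, val A = map fst g -> Gamma_rel A (spots g) g].
Proof.
move=> gS; have [gk gP _] := SigmaP n_gt0 gS.
set s := hurwitz_sort g; have sP : all (@proper_tr n) s := proper_hurwitz_sort gP.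
have sk : size s = k by rewrite size_hurwitz_sort.
have sS : Sigma k s.
  by apply: Sigma_same_prod gS; rewrite // ?prod_hurwitz_sort ?size_hurwitz_sort.
have sL : pairwise (@fst_le n) s := sorted_hurwitz_sort gP.
have sN := Sigma_noncrossing n_gt0 sL sS.
have os : o \notin map snd s.
  by apply/mapP => -[t /(allP sP)]; rewrite /proper_tr => + e; rewrite -e o0.
have cB : #|spots g| = k.+1.
  rewrite cardsU1 inE os; congr _.+1.
  by rewrite cardsE (card_uniqP (noncrossing_uniq sN)) size_map.
have pk : park (spots g) (map fst s) = map snd s.
  apply: noncrossing_park => // [x xs|y]; first by rewrite !inE xs orbT.
  (* The spare spot [o] is the least point, so it is interior to no interval. *)
  by rewrite !inE => /orP[/eqP-> _ t _|->] //; rewrite o0.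
have fo : free_spots (spots g) (map fst g) = [set o].
  rewrite -(free_spots_perm _ (perm_fst_hurwitz_sort gP)) -free_spotsE pk.
  apply/setP => x; rewrite !inE; case: eqP => [->|_] /=; first by rewrite (negPf os).
  by rewrite andNb.
split=> // A eA; rewrite -eA in fo.
have eAt : Atil A (spots g) = A by rewrite /Atil (rho_exp1 fo) o0 subn0 shiftA_n.
have eBt : Btil A (spots g) = spots g by rewrite /Btil (rho_exp1 fo) o0 subn0 shiftB_n.
have eI : Iseq A (spots g) = map fst s :> seq _.
  apply: (@sorted_eq _ (fun x y : 'I_n => x <= y)).
  - by move=> x y z; apply: leq_trans.
  - by move=> x y /anti_leq/val_inj.
  - by apply: sort_sorted => x y; apply: leq_total.
  - rewrite sorted_pairwise; last by move=> x y z; apply: leq_trans.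
    by rewrite pairwise_map.
  - apply: perm_trans (perm_Iseq _ _) _; rewrite eAt perm_sym [tval A]eA.
    exact: perm_fst_hurwitz_sort.
split=> //; first by rewrite eAt -eA.
by rewrite /gamma0 /Jseq eBt eI pk zip_unzip.
Qed.

Lemma Sigma_surj g : Sigma k g -> exists A B, #|B| = k.+1 /\ Gamma_rel A B g.
Proof.
move=> gS; have [cB _ gR] := spots_Sigma gS.
have [gk _ _] := SigmaP n_gt0 gS.
have sA : size (map fst g) == k by rewrite size_map gk.
by exists (Tuple sA), (spots g); split=> //; apply: gR.
Qed.

Lemma cpow_inj_exp v (m m' : 'I_n) : cpow n m v = cpow n m' v -> m = m'.
Proof.
move=> /(congr1 val) /=; rewrite !cpowE => /eqP; rewrite eqn_modDl !modn_small //.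
by move/eqP/val_inj.
Qed.

(** Shifts by distinct [m] give distinct residues [cpow n m v]. *)
Lemma card_orbit A B : #|B| = k.+1 ->
  #|[set (shiftA m A, shiftB m B) | m : 'I_n]| = n.
Proof.
move=> /(free_spots_residue A)[v ev]; rewrite card_imset ?card_ord //.
move=> m m' [eA eB]; apply: (@cpow_inj_exp v); apply: set1_inj.
rewrite -!(free_spots_shiftA _ ev) eB; congr (free_spots _ (tval _)).
exact: val_inj.
Qed.

Lemma card_Sigma :
  n * #|[set g : k.-tuple (transp n) | Sigma k g]| = n ^ k * 'C(n, k.+1).
Proof.
set S := [set g : k.-tuple (transp n) | Sigma k g].
(* Shifting the preimage of residue [o] by all exponents gives a bijection onto the pairs
   [(A, B)]. *)
pose h (p : 'I_n * k.-tuple (transp n)) :=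
  (shiftA p.1 (map_tuple fst p.2), shiftB p.1 (spots p.2)).
pose X := setX [set: k.-tuple 'I_n] [set B : {set 'I_n} | #|B| == k.+1].
have cX : #|X| = n ^ k * 'C(n, k.+1).
  by rewrite cardsX cardsT card_tuple card_ord card_draws card_ord.
rewrite -cX -[n in n * _]card_ord -cardsT -cardsX.
have <- : h @: setX [set: 'I_n] S = X.
  apply/setP => -[A B]; rewrite !inE /=; apply/imsetP/eqP => [[[m g]]|cB].
    rewrite !inE /= => gS [_ ->]; rewrite card_shiftB.
    by have [] := spots_Sigma gS.
  have [g gR] := Gamma_rel_ex A cB; have gS := Gamma_rel_Sigma cB gR.
  have [gk _ _] := SigmaP n_gt0 gS; case: gR => _ gf gs.
  have [v ev] := free_spots_residue A cB.
  have sg : size g == k by rewrite gk.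
  (* Normalisation shifts by [n - v], so the residue [v] is the exponent that restores [(A, B)]. *)
  exists (v, Tuple sg); first by rewrite !inE.
  have vn := ltnW (ltn_ord v); rewrite /h /=; congr pair.
    rewrite (_ : map_tuple fst _ = Atil A B); last exact: val_inj.
    by rewrite /Atil (rho_exp1 ev) shiftA_comp subnK ?shiftA_n.
  rewrite /spots gs -Btil_gamma0 // /Btil (rho_exp1 ev) shiftB_comp.
  by rewrite subnK ?shiftB_n.
rewrite card_in_imset // => -[m g] [m' g']; rewrite !inE /= => gS g'S [eA eB].
have [_ fo gR] := spots_Sigma gS; have [_ fo' gR'] := spots_Sigma g'S.
have eA' : shiftA m (map_tuple fst g) = shiftA m' (map_tuple fst g') by apply: val_inj.
(* The exponent is read off from the residue, which is [cpow n m o]. *)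
have em : m = m'.
  apply: (@cpow_inj_exp o); apply: set1_inj.
  rewrite -(@free_spots_shiftA m (map_tuple fst g) (spots g)) // eA' eB.
  exact: (@free_spots_shiftA m' (map_tuple fst g') (spots g')).
subst m'; congr pair.
have nm : m + (n - m) = n by rewrite subnKC // ltnW.
move: (congr1 (shiftA (n - m)) eA') (congr1 (shiftB (n - m)) eB).
rewrite !shiftA_comp !shiftB_comp nm !shiftA_n !shiftB_n => e1 e2.
apply: val_inj; apply: (@Gamma_rel_inj (map_tuple fst g) (spots g)).
  exact: gR.
by rewrite e1 e2; apply: gR'.
Qed.

End Gamma.

Theorem mainTheorem13 (n k : nat) (hn : 1 <= n) :
  (* pointwise part, for every (A, B) *)
  (forall (A : k.-tuple 'I_n) (B : {set 'I_n}), #|B| = k.+1 ->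
     all (fun t : transp n => t.1 < t.2) (gamma0 A B) /\
     Sigma k (gamma0 A B) /\
     exists g : seq (transp n), Gamma_is A B g /\ Sigma k g) /\
  (* surjectivity onto Sigma_n(k) *)
  (forall g : seq (transp n), Sigma k g ->
     exists (A : k.-tuple 'I_n) (B : {set 'I_n}), #|B| = k.+1 /\ Gamma_is A B g) /\
  (* fibres are exactly the shift orbits *)
  (forall (A A' : k.-tuple 'I_n) (B B' : {set 'I_n}) (g g' : seq (transp n)),
     #|B| = k.+1 -> #|B'| = k.+1 -> Gamma_is A B g -> Gamma_is A' B' g' ->
     (g = g' <-> exists m : nat, A' = shiftA m A /\ B' = shiftB m B)) /\
  (* each orbit has exactly n elements *)
  (forall (A : k.-tuple 'I_n) (B : {set 'I_n}), #|B| = k.+1 ->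
     #|[set (shiftA m A, shiftB m B) | m : 'I_n]| = n) /\
  (* |Sigma_n(k)| = n^(k-1) * binom(n, k+1), i.e. n * |Sigma_n(k)| = n^k binom *)
  n * #|[set g : k.-tuple (transp n) | Sigma k g]| = n ^ k * 'C(n, k.+1).
Proof.
have o0 : Ordinal hn = 0 :> nat by [].
split; [|split; [|split; [|split]]].
- move=> A B cB; have /andP[gP _] := gamma0_noncrossing o0 A cB.
  split=> //; split; first exact: gamma0_Sigma o0 _ _ cB.
  have [g gR] := Gamma_rel_ex o0 A cB; exists g.
  by split; [apply/(Gamma_isP o0 A g cB) | apply: (Gamma_rel_Sigma o0 cB gR)].
- move=> g /(Sigma_surj o0)[A [B [cB gR]]]; exists A, B.
  by split=> //; apply/(Gamma_isP o0 A g cB).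
- move=> A A' B B' g g' cB cB' /(Gamma_isP o0 A g cB) gR /(Gamma_isP o0 A' g' cB') gR'.
  exact: (Gamma_rel_fibre o0 cB cB' gR gR').
- by move=> A B cB; apply: card_orbit.
- exact: (card_Sigma k o0).
Qed.
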